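(* Let $p\ne\ell$ be distinct primes, $q$ a power of $p$, $G$ a finite abelian group equipped with an automorphism $g\mapsto g^{\sigma_q}$, $R$ a field extension of $\mathbb Q_\ell$ (on which $\sigma_q$ acts trivially), and $d\ge 0$ an integer. Let $M$ be a finite free $R$-module with an $R$-linear action of $G$ and an operator $\sigma_q:M\to M$ that is semilinear, i.e. $\sigma_q(rm)=\sigma_q(r)\sigma_q(m)$ for all $r\in R[G]$, $m\in M$. Suppose that: (1) there exists a $G$-equivariant surjection $R[G]\to M$; (2) there is a perfect pairing $\langle-,-\rangle: M\otimes_R M\to R(-d)$, equivariant for $G$ and $\sigma_q$. Suppose that for each character $\chi$ of $G$ occurring in $M$, the character $\chi^{-1}$ is in the $\sigma_q$-orbit of $\chi$. Then $M$ is supersingular.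
   Context: The automorphism $\sigma_q$ of $G$ is extended to $R[G]$ by $\sigma_q(\sum_h a_h[h])=\sum_h \sigma_q(a_h)[h^{\sigma_q}]$ (here $\sigma_q(a_h)=a_h$). $R(-d)$ is the free rank-one $R$-module on which $G$ acts trivially and which has a generator $e$ with $\sigma_q(e)=q^d e$. With $n=|G|$, characters of $G$ are homomorphisms $\chi:G\to R(\mu_n)^\times$. A character $\chi$ occurs in $M$ if the eigenspace $\{m: g(m)=\chi(g)m \text{ for all } g\in G\}$ in $\overline M=M\otimes_R\overline R$ is nonzero. $\sigma_q$ permutes characters by $\chi\mapsto\chi^{\sigma_q}:=\chi\circ\sigma_q^{-1}$, and the $\sigma_q$-orbit of $\chi$ is its orbit under this action. $M$ is called supersingular if all the eigenvalues of $\sigma_q$ are of the form $q^e\zeta$ with $e\in\frac12\mathbb Z_{\ge 0}$ and $\zeta$ a root of unity. *)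

(* Defs.v *)
From HB Require Import structures.
From mathcomp Require Import all_boot all_order all_algebra all_fingroup.
From mathcomp Require Import boolp.

Set Implicit Arguments.
Unset Strict Implicit.
Unset Printing Implicit Defensive.

Import GRing.Theory.
Import passmx.
Local Open Scope ring_scope.

(* The ring Z_l as the inverse limit of the rings Z/l^n: an element is its    *)
(* sequence of least nonnegative residues mod l^n, n >= 0 (the single         *)
(* condition below says both that residues are reduced and that they are      *)
(* compatible).                                                               *)
Record padic_int (l : nat) (l_prime : prime l) := PadicInt {
  residue :> nat -> nat;
  residue_compat : forall n, residue n = (residue n.+1 %% l ^ n)%N }.

Section PadicInt.
Variables (l : nat) (l_prime : prime l).
Local Notation Zl := (padic_int l_prime).

Lemma padic_eq (x y : Zl) : x =1 y -> x = y.
Proof.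
case: x y => [x hx] [y hy] /= /funext exy; rewrite exy in hx *.
by congr PadicInt; apply: Prop_irrelevance.
Qed.

Lemma residue_mod (x : Zl) m n : (m <= n)%N -> (x n %% l ^ m)%N = x m.
Proof.
elim: n => [|n IHn]; first by rewrite leqn0 => /eqP->; rewrite (residue_compat x 0) modn_mod.
rewrite leq_eqVlt => /predU1P[->|]; first by rewrite (residue_compat x n.+1) modn_mod.
rewrite ltnS => lemn; rewrite -[RHS](IHn lemn) (residue_compat x n).
by rewrite modn_dvdm ?dvdn_exp2l.
Qed.

Lemma residue_reduced (x : Zl) n : (x n %% l ^ n)%N = x n.
Proof. exact: residue_mod. Qed.

Lemma reduce_compat (f : nat -> nat) :
  (forall n, f n.+1 = f n %[mod l ^ n])%N ->
  forall n, (f n %% l ^ n = (f n.+1 %% l ^ n.+1) %% l ^ n)%N.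
Proof. by move=> hf n; rewrite modn_dvdm ?dvdn_exp2l ?hf. Qed.

Definition padic_of f hf : Zl := PadicInt l_prime (@reduce_compat f hf).

Lemma const_compat k n : (k = k %[mod l ^ n])%N. Proof. by []. Qed.

Lemma add_compat (x y : Zl) n : (x n.+1 + y n.+1 = x n + y n %[mod l ^ n])%N.
Proof. by rewrite -modnDm -!residue_compat. Qed.

Lemma mul_compat (x y : Zl) n : (x n.+1 * y n.+1 = x n * y n %[mod l ^ n])%N.
Proof. by rewrite -modnMm -!residue_compat. Qed.

Lemma opp_compat (x : Zl) n :
  ((l ^ n.+1).-1 * x n.+1 = (l ^ n).-1 * x n %[mod l ^ n])%N.
Proof.
have l0 := prime_gt0 l_prime.
apply/eqP; rewrite -(eqn_modDr (x n.+1)) addnC -mulSn prednK ?expn_gt0 ?l0 //.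
rewrite -modnDmr -residue_compat [X in _ == X %[mod _]]addnC -mulSn.
by rewrite prednK ?expn_gt0 ?l0 // expnSr -mulnA !modnMr.
Qed.

Definition padic_zero : Zl := padic_of (const_compat 0).
Definition padic_one : Zl := padic_of (const_compat 1).
Definition padic_add (x y : Zl) : Zl := padic_of (add_compat x y).
Definition padic_opp (x : Zl) : Zl := padic_of (opp_compat x).
Definition padic_mul (x y : Zl) : Zl := padic_of (mul_compat x y).

HB.instance Definition _ := gen_eqMixin Zl.
HB.instance Definition _ := gen_choiceMixin Zl.

Lemma padic_addA : associative padic_add.
Proof. by move=> x y z; apply: padic_eq => n /=; rewrite modnDml modnDmr addnA. Qed.
Lemma padic_addC : commutative padic_add.
Proof. by move=> x y; apply: padic_eq => n /=; rewrite addnC. Qed.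
Lemma padic_add0 : left_id padic_zero padic_add.
Proof. by move=> x; apply: padic_eq => n /=; rewrite mod0n add0n residue_reduced. Qed.
Lemma padic_addN : left_inverse padic_zero padic_opp padic_add.
Proof.
move=> x; apply: padic_eq => n /=; rewrite modnDml addnC -mulSn.
by rewrite prednK ?expn_gt0 ?prime_gt0 // modnMr mod0n.
Qed.

HB.instance Definition _ :=
  GRing.isZmodule.Build Zl padic_addA padic_addC padic_add0 padic_addN.

Lemma padic_mulA : associative padic_mul.
Proof. by move=> x y z; apply: padic_eq => n /=; rewrite modnMml modnMmr mulnA. Qed.
Lemma padic_mulC : commutative padic_mul.
Proof. by move=> x y; apply: padic_eq => n /=; rewrite mulnC. Qed.
Lemma padic_mul1 : left_id padic_one padic_mul.
Proof. by move=> x; apply: padic_eq => n /=; rewrite modnMml mul1n residue_reduced. Qed.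
Lemma padic_mulD : left_distributive padic_mul padic_add.
Proof.
by move=> x y z; apply: padic_eq => n /=; rewrite modnMml modnDm mulnDl.
Qed.
Lemma padic_one_neq0 : padic_one != padic_zero.
Proof.
apply/eqP => /(congr1 (fun x : Zl => x 1%N)) /=.
by rewrite expn1 mod0n modn_small ?prime_gt1.
Qed.

HB.instance Definition _ := GRing.Zmodule_isComNzRing.Build Zl
  padic_mulA padic_mulC padic_mul1 padic_mulD padic_one_neq0.

Definition padic_unit : pred Zl := fun x => `[< exists y : Zl, y * x = 1 >].
Definition padic_inv (x : Zl) : Zl :=
  if pselect (exists y : Zl, y * x = 1) is left h then projT1 (cid h) else x.

Lemma padic_mulV : {in padic_unit, left_inverse 1 padic_inv *%R}.
Proof.
by move=> x /asboolP hx; rewrite /padic_inv; case: pselect => // h; case: cid.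
Qed.
Lemma padic_unitP (x y : Zl) : y * x = 1 -> padic_unit x.
Proof. by move=> yx; apply/asboolP; exists y. Qed.
Lemma padic_inv_out : {in [predC padic_unit], padic_inv =1 id}.
Proof.
by move=> x /asboolPn hx; rewrite /padic_inv; case: pselect.
Qed.

HB.instance Definition _ := GRing.ComNzRing_hasMulInverse.Build Zl
  padic_mulV padic_unitP padic_inv_out.

Lemma padic_neq0 (x : Zl) : x != 0 -> exists n, x n <> 0%N.
Proof.
move=> x0; apply: contrapT => /forallNP h; move/eqP: x0; apply.
by apply: padic_eq => n /=; rewrite mod0n; apply: contrapT (h n).
Qed.

Lemma padic_idomain : GRing.integral_domain_axiom Zl.
Proof.
move=> x y xy0; apply/norP => -[/padic_neq0[a xa] /padic_neq0[b yb]].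
have val (z : Zl) c n : z c <> 0%N -> (c <= n)%N ->
    (0 < z n)%N /\ (logn l (z n) < c)%N.
  move=> zc lecn; have zn : ~~ (l ^ c %| z n)%N.
    by rewrite /dvdn residue_mod //; apply/eqP.
  have z0 : (0 < z n)%N by case: (z n) zn => //; rewrite dvdn0.
  by split=> //; rewrite ltnNge -pfactor_dvdn.
have [x0 vx] := val _ _ _ xa (leq_addr b a).
have [y0 vy] := val _ _ _ yb (leq_addl a b).
have /= := congr1 (fun z : Zl => z (a + b)%N) xy0.
rewrite mod0n => /eqP; rewrite -/(dvdn _ _) pfactor_dvdn ?muln_gt0 ?x0 //.
rewrite lognM // leqNgt => /negP; apply.
by rewrite -addnS leq_add // ltnW.
Qed.

HB.instance Definition _ := GRing.ComUnitRing_isIntegral.Build Zl padic_idomain.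

End PadicInt.

Definition padic (l : nat) (l_prime : prime l) : fieldType :=
  {fraction (padic_int l_prime)}.

(* Rbar is algebraically closed by its type.                                  *)
Definition is_algebraic_closure (R : fieldType) (Rbar : closedFieldType)
  (iota : {rmorphism R -> Rbar}) := forall x, algebraicOver iota x.

(* M \otimes_R Rbar in coordinates: writing M as R^n in the basis             *)
(* vbasis {:M}, the extension of scalars is Rbar^n.                           *)
Section BaseChange.
Variables (R Rbar : fieldType) (iota : {rmorphism R -> Rbar}) (M : vectType R).

Definition ext_scalars : vectType Rbar := 'rV[Rbar]_(\dim {:M}).

Definition ext_vec (m : M) : ext_scalars :=
  map_mx iota (rVof (vbasis {:M}) m).

Definition ext_end (f : 'End(M)) : 'End(ext_scalars) :=
  linfun (mulmxr (map_mx iota (mxof (vbasis {:M}) (vbasis {:M}) f))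
          : ext_scalars -> ext_scalars).

Lemma ext_endE f m : ext_end f (ext_vec m) = ext_vec (f m).
Proof.
by rewrite /ext_end lfunE /= -map_mxM -rVof_app // vbasisP.
Qed.
End BaseChange.

Section GroupRing.
Variables (R : fieldType) (G : finGroupType) (M : vectType R).

(* The R[G]-module underlying the group ring: sum_h a_h [h] is encoded by     *)
(* its coefficient function h |-> a_h.                                        *)
Definition group_ring : vectType R := {ffun G -> R^o}.

Definition is_lin_rep (rho : G -> 'End(M)) :=
  rho 1%g = \1%VF /\ forall g h, rho (g * h)%g = (rho g \o rho h)%VF.

Definition gr_translate (g : G) (r : {ffun G -> R^o}) : group_ring :=
  [ffun h => r (g^-1 * h)%g].

Definition gr_scale (rho : G -> 'End(M)) (r : {ffun G -> R^o}) (m : M) : M :=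
  \sum_(g : G) r g *: rho g m.

Definition gr_aut (sigma : {perm G}) (r : {ffun G -> R^o}) : {ffun G -> R^o} :=
  [ffun h => r (sigma^-1%g h)].

(* sigma_q fixes R, so an operator on M that is semilinear over R[G] is in     *)
(* particular R-linear; this part is built into the type 'End(M) of Sq.       *)
Definition semilinear_op (sigma : {perm G}) (rho : G -> 'End(M))
    (Sq : 'End(M)) :=
  forall (r : {ffun G -> R^o}) (m : M),
    Sq (gr_scale rho r m) = gr_scale rho (gr_aut sigma r) (Sq m).

Definition equivariant_surjection (rho : G -> 'End(M)) :=
  exists pi : 'Hom(group_ring, M),
    (forall g r, pi (gr_translate g r) = rho g (pi r)) /\
    (forall m, exists r, pi r = m).

End GroupRing.

Section Pairing.
Variables (R : fieldType) (G : finGroupType) (M : vectType R).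

(* sigma_q on R(-d), whose underlying R-module is R^o with generator 1.       *)
Definition tate_frob (q d : nat) : 'End(R^o) :=
  (q%:R ^+ d *: \1)%VF.

Definition perfect_pairing (B : {bilinear M -> M -> R^o}) :=
  bijective (fun x => linfun (B x)) /\
  bijective (fun y => linfun (fun x => B x y)).

Definition equivariant_pairing (q d : nat) (rho : G -> 'End(M)) (Sq : 'End(M))
    (B : {bilinear M -> M -> R^o}) :=
  (forall g x y, B (rho g x) (rho g y) = B x y) /\
  (forall x y, B (Sq x) (Sq y) = tate_frob q d (B x y)).

End Pairing.

Section Characters.
Variables (R : fieldType) (Rbar : fieldType) (iota : {rmorphism R -> Rbar}).
Variable G : finGroupType.

(* The subfield R(mu_n) of Rbar.                                              *)
Definition in_cyclo_ext (n : nat) (x : Rbar) :=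
  forall K : {pred Rbar}, divring_closed K ->
    (forall a, iota a \in K) -> (forall z, z ^+ n = 1 -> z \in K) -> x \in K.

Definition is_char (chi : G -> Rbar) :=
  [/\ chi 1%g = 1,
      forall g h, chi (g * h)%g = chi g * chi h &
      forall g, in_cyclo_ext #|G| (chi g)].

Definition char_occurs (M : vectType R) (rho : G -> 'End(M))
    (chi : G -> Rbar) :=
  exists2 v : ext_scalars Rbar M, v != 0 &
    forall g, ext_end iota (rho g) v = chi g *: v.

Definition char_twist (sigma : {perm G}) (chi : G -> Rbar) : G -> Rbar :=
  fun g => chi (sigma^-1%g g).

Definition char_inv (chi : G -> Rbar) : G -> Rbar := fun g => (chi g)^-1.

(* psi lies in the orbit of chi under the group generated by sigma.           *)
Definition in_char_orbit (sigma : {perm G}) (chi psi : G -> Rbar) :=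
  exists2 t, t \in <[sigma]>%g & psi =1 char_twist t chi.

(* q^e zeta with e = k/2 is sqrt(q)^k zeta; the choice of the square root is  *)
(* immaterial since -1 is a root of unity.                                    *)
Definition supersingular (q : nat) (M : vectType R) (Sq : 'End(M)) :=
  forall lam : Rbar, leigenvalue (ext_end iota Sq) lam ->
    exists (s zeta : Rbar) (k m : nat),
      [/\ s ^+ 2 = q%:R, (0 < m)%N, m.-unity_root zeta & lam = s ^+ k * zeta].

End Characters.

(* Main.v *)
(* Let a be the order of sigma and lam an eigenvalue of sigma_q. As           *)
(* sigma_q^a commutes with G, its lam^a-eigenspace contains a common          *)
(* eigenvector u of G, of character chi say. Cyclicity makes all weight       *)
(* spaces of M lines; by the orbit hypothesis w = sigma_q^k u spans the       *)
(* chi^-1 line for some k, which the pairing puts in duality with the chi     *)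
(* line, so <u, w> != 0. Since sigma_q^a multiplies both u and w by lam^a and *)
(* the pairing by q^(d a), lam^(2 a) = q^(d a).                               *)
Require Import Defs.
From HB Require Import structures.
From mathcomp Require Import all_boot all_order all_algebra all_fingroup.
From mathcomp Require Import cyclic.
Set Implicit Arguments.
Unset Strict Implicit.
Unset Printing Implicit Defensive.
Import GRing.Theory passmx.
Local Open Scope ring_scope.

(** The argument runs over [Rbar], where [#|G|] and [q] are nonzero because [R] contains the l-adic
    numbers. Starting from an eigenvector of [sigma_q], [common_eigenvector_in_orbit] reaches a
    vector [u] of some weight [chi] using only operators that commute with [sigma_q^a], so [u] keeps
    the eigenvalue [lam^a]. Nonvanishing of the pairing between [chi] and [chi^-1] is
    [dual_weights_pair], which rests on averaging over [G] and on cyclicity. The resulting identity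
    [lam^(2 a) = q^(d a)] ([eigenvalue_pow]) makes [lam / sqrt(q)^d] a root of unity. *)

Lemma padic_natr_neq0 (l : nat) (l_prime : prime l) (k : nat) :
  (0 < k)%N -> k%:R != 0 :> padic l_prime.
Proof.
move=> k_gt0; rewrite -tofrac1 -tofracMn tofrac_eq0; apply/eqP.
have natr_residue m i : (m%:R : padic_int l_prime) i = (m %% l ^ i)%N.
  elim: m => [|m IHm]; first exact: erefl.
  by rewrite mulrS [LHS]/= IHm modnDm add1n.
move=> k0; have := natr_residue k k; rewrite k0.
have -> : (0 : padic_int l_prime) k = 0%N by exact: mod0n.
(* Since [k < l^k], the residue of [k] modulo [l^k] is [k] itself. *)
rewrite (modn_small (ltn_expl _ (prime_gt1 l_prime))) => k00.
by rewrite -k00 in k_gt0.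
Qed.

(** * Common eigenvectors of commuting matrices *)

Section Eigenvectors.
Variables (K : closedFieldType) (n : nat).
Implicit Types (A B : 'M[K]_n) (u v : 'rV[K]_n).

(** By Cayley-Hamilton the product of the [A - r], over the roots [r] of the characteristic
    polynomial, kills [v]. Apply the factors one at a time: the last nonzero vector is an
    eigenvector, and [X] is the product of the factors used so far. *)
Lemma eigenvector_in_orbit A v : v != 0 ->
  exists X : 'M[K]_n, [/\ v *m X != 0,
    exists a, v *m X *m A = a *: (v *m X) &
    forall B, comm_mx A B -> comm_mx X B].
Proof.
case: n A v => [|n'] A v v_neq0; first by rewrite thinmx0 eqxx in v_neq0.
have [rs char_rs] := closed_field_poly_normal (char_poly A).
have: v *m horner_mx A (\prod_(z <- rs) ('X - z%:P)) = 0.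
  apply/eqP; rewrite -[X in _ *m horner_mx A X]scale1r.
  rewrite -(monicP (char_poly_monic A)) -char_rs.
  by rewrite Cayley_Hamilton mulmx0.
elim: rs v v_neq0 {char_rs} => [|r rs IHrs] v v_neq0.
  by rewrite big_nil rmorph1 mulmx1 => v0; rewrite v0 eqxx in v_neq0.
rewrite big_cons rmorphM mulmxA rmorphB /= horner_mx_X horner_mx_C.
have [vA|vA_neq0 /(IHrs _ vA_neq0)[X [vX [a Xa] Xcomm]]] :=
    eqVneq (v *m (A - r%:M)) 0.
  move=> _; exists 1%:M; rewrite mulmx1; split=> //; last first.
    by move=> B _; rewrite /comm_mx mul1mx mulmx1.
  exists r; apply/eqP; rewrite -subr_eq0 -mul_mx_scalar -mulmxBr; exact/eqP.
exists ((A - r%:M) *m X); rewrite mulmxA; split=> //; first by exists a.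
move=> B AB; apply/comm_mx_sym/comm_mxM; apply/comm_mx_sym; last exact: Xcomm.
apply/comm_mx_sym/comm_mxB; first exact/comm_mx_sym.
exact: comm_mx_scalar.
Qed.

Lemma common_eigenvector_in_orbit (As : seq 'M[K]_n) v :
    v != 0 -> {in As &, forall A B, comm_mx A B} ->
  exists X : 'M[K]_n, [/\ v *m X != 0,
    forall A, A \in As -> exists a, v *m X *m A = a *: (v *m X) &
    forall B, (forall A, A \in As -> comm_mx A B) -> comm_mx X B].
Proof.
move=> v_neq0; elim: As => [|A As IHAs] AsC.
  exists 1%:M; rewrite mulmx1; split=> // B _.
  by rewrite /comm_mx mul1mx mulmx1.
have [|X [vX Xeig XC]] := IHAs.
  by move=> B C BAs CAs; apply: AsC; rewrite inE ?BAs ?CAs orbT.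
have [Y [vXY [a Ya] YC]] := eigenvector_in_orbit A vX.
exists (X *m Y); rewrite mulmxA; split=> //.
  move=> B; rewrite inE => /predU1P[->|BAs]; first by exists a.
  have [b vb] := Xeig _ BAs; exists b.
  (* [Y] commutes with the earlier matrices, so it preserves their eigenvectors. *)
  rewrite -mulmxA YC ?mulmxA ?vb ?scalemxAl //.
  by apply: AsC; rewrite inE ?eqxx ?BAs ?orbT.
move=> B BC; apply/comm_mx_sym/comm_mxM; apply/comm_mx_sym.
  by apply: XC => C CAs; apply: BC; rewrite inE CAs orbT.
by apply: YC; apply: BC; rewrite inE eqxx.
Qed.

End Eigenvectors.

(** * Weight lines and their duality under a semilinear similitude *)

(* Row vectors are acted on from the right, so composites of endomorphisms    *)
(* correspond to matrix products in the reverse order.                        *)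
Section MatrixForm.
Variables (K : closedFieldType) (n : nat) (G : finGroupType).
Variables (sigma : {perm G}) (A : G -> 'M[K]_n) (S B : 'M[K]_n).
Variables (c : K) (m : 'rV[K]_n).
Hypothesis cardG_neq0 : #|G|%:R != 0 :> K.
Hypothesis A1 : A 1%g = 1%:M.
Hypothesis AM : forall g h, A (g * h)%g = A g *m A h.
Hypothesis AC : forall g h, comm_mx (A g) (A h).
Hypothesis AS : forall g, A g *m S = S *m A (sigma g).
Hypothesis m_gen : forall v : 'rV[K]_n,
  exists r : G -> K, v = \sum_g r g *: (m *m A g).
Hypothesis B_free : row_free B.
Hypothesis AB : forall g, A g *m B *m (A g)^T = B.
Hypothesis SB : S *m B *m S^T = c *: B.
Hypothesis c_neq0 : c != 0.

Lemma mx_semilinearX k g : A g *m S ^+ k = S ^+ k *m A ((sigma ^+ k)%g g).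
Proof.
elim: k g => [|k IHk] g; first by rewrite expr0 expg0 perm1 mulmx1 mul1mx.
by rewrite exprSr expgSr permM mulmxA IHk -!mulmxA AS.
Qed.

Lemma mx_similitudeX k : S ^+ k *m B *m (S ^+ k)^T = c ^+ k *: B.
Proof.
elim: k => [|k IHk]; first by rewrite expr0 trmx1 mulmx1 mul1mx scale1r.
rewrite {1}exprSr exprSr trmx_mul !mulmxA -(mulmxA _ S) -(mulmxA _ _ S^T) SB.
by rewrite -scalemxAr -scalemxAl IHk scalerA exprS.
Qed.

Lemma mx_similitudeX_inj k (v : 'rV[K]_n) : v *m S ^+ k = 0 -> v = 0.
Proof.
move=> vS; apply/eqP; rewrite -(mulmx_free_eq0 v B_free).
apply/eqP/(scalerI (expf_neq0 k c_neq0)).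
by rewrite scaler0 scalemxAr -mx_similitudeX !mulmxA vS !mul0mx.
Qed.

Definition is_weight (chi : G -> K) (v : 'rV[K]_n) :=
  forall g, v *m A g = chi g *: v.

Section Projector.
Variable chi : G -> K.
Hypothesis chiM : forall g h, chi (g * h)%g = chi g * chi h.
Hypothesis chi1 : chi 1%g = 1.

Lemma chiV g : chi g * chi g^-1%g = 1.
Proof. by rewrite -chiM mulgV chi1. Qed.

Lemma chi_neq0 g : chi g != 0.
Proof.
by apply: contra_eq_neq (chiV g) => ->; rewrite mul0r eq_sym oner_neq0.
Qed.

(* #|G| times the projector onto the chi^-1 weight space. *)
Definition dual_proj : 'M[K]_n := \sum_g chi g *: A g.

(** Since [A h *m dual_proj = chi h^-1 *: dual_proj], every translate of the generator [m] has image
    on the line of [m *m dual_proj]. *)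
Lemma dual_proj_cyclic (v : 'rV[K]_n) :
  exists a, v *m dual_proj = a *: (m *m dual_proj).
Proof.
have [r ->] := m_gen v; exists (\sum_h r h * chi h^-1%g).
rewrite mulmx_suml scaler_suml; apply: eq_bigr => h _.
rewrite -scalemxAl -scalerA; congr (_ *: _).
rewrite /dual_proj !mulmx_sumr scaler_sumr.
rewrite [RHS](reindex_inj (mulgI h)); apply: eq_bigr => g _ /=.
rewrite -!scalemxAr scalerA AM mulmxA; congr (_ *: _).
by rewrite chiM mulrA [chi h^-1%g * _]mulrC chiV mul1r.
Qed.

(** Against a vector of weight [chi], invariance of the form moves each [A g] across the pairing,
    where it cancels the coefficient [chi g]. *)
Lemma dual_proj_form (u : 'rV[K]_n) : is_weight chi u ->
  u *m B *m dual_proj^T = #|G|%:R *: (u *m B).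
Proof.
move=> uchi; rewrite /dual_proj linear_sum mulmx_sumr -sum1_card natr_sum.
rewrite scaler_suml; apply: eq_bigr => g _; rewrite linearZ -scalemxAr /=.
by rewrite !(scalemxAl (chi g)) -uchi -!mulmxA (mulmxA (A g)) AB scale1r.
Qed.

Lemma dual_proj_weight (w : 'rV[K]_n) : is_weight (fun g => (chi g)^-1) w ->
  w *m dual_proj = #|G|%:R *: w.
Proof.
move=> wchi; rewrite /dual_proj mulmx_sumr -sum1_card natr_sum scaler_suml.
apply: eq_bigr => g _.
by rewrite -scalemxAr wchi scalerA divff ?chi_neq0.
Qed.

(** The vector [w] spans the image of [dual_proj]. If [u] were orthogonal to [w], it would be
    orthogonal to that whole image, hence to every vector by [dual_proj_form], against
    nondegeneracy. *)
Lemma dual_weights_pair (u w : 'rV[K]_n) : u != 0 -> w != 0 ->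
    is_weight chi u -> is_weight (fun g => (chi g)^-1) w ->
  u *m B *m w^T != 0.
Proof.
move=> u_neq0 w_neq0 uchi wchi; apply: contra_neq u_neq0 => uBw.
have [a wa] := dual_proj_cyclic w; rewrite dual_proj_weight // in wa.
have a_neq0 : a != 0.
  apply: contra_neq w_neq0 => a0; apply: (scalerI cardG_neq0).
  by rewrite wa a0 scale0r scaler0.
have uBm : u *m B *m (m *m dual_proj)^T = 0.
  apply: (scalerI a_neq0); rewrite scalemxAr -linearZ /= -wa linearZ /=.
  by rewrite -scalemxAr uBw !scaler0.
apply/eqP; rewrite -(mulmx_free_eq0 u B_free); apply/eqP/rowP => j.
rewrite [RHS]mxE; apply: (mulfI cardG_neq0); rewrite mulr0.
pose y : 'rV[K]_n := delta_mx 0 j; have [b yb] := dual_proj_cyclic y.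
have : u *m B *m (y *m dual_proj)^T = 0.
  by rewrite yb linearZ -scalemxAr uBm scaler0.
rewrite trmx_mul mulmxA dual_proj_form // -scalemxAl trmx_delta -colE.
by move=> /matrixP/(_ 0 0); rewrite !mxE.
Qed.

End Projector.

Lemma eigenvalue_pow (lam : K) (v : 'rV[K]_n) :
    (forall chi : G -> K, chi 1%g = 1 ->
        (forall g h, chi (g * h)%g = chi g * chi h) ->
        (exists2 u, u != 0 & is_weight chi u) ->
      exists k, forall g, (chi g)^-1 = chi ((sigma ^+ k)^-1%g g)) ->
    v != 0 -> v *m S = lam *: v ->
  (lam ^+ #[sigma]%g) ^+ 2 = c ^+ #[sigma]%g.
Proof.
move=> orb v_neq0 vS; set a := #[sigma]%g.
have [|X [vX eigX XC]] := @common_eigenvector_in_orbit _ _ (codom A) v v_neq0.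
  by move=> _ _ /codomP[g ->] /codomP[h ->].
set u := v *m X in vX eigX.
have vSX k : v *m S ^+ k = lam ^+ k *: v.
  elim: k => [|k IHk]; first by rewrite expr0 mulmx1 scale1r.
  by rewrite exprSr mulmxA IHk -scalemxAl vS scalerA -exprSr.
(* [sigma^a = 1], so [S ^+ a] commutes with every [A g], hence with [X]. *)
have uSa : u *m S ^+ a = lam ^+ a *: u.
  rewrite /u -mulmxA XC ?mulmxA ?vSX -?scalemxAl // => _ /codomP[g ->].
  by rewrite /comm_mx mx_semilinearX expg_order perm1.
have /fin_all_exists[chi uchi] g : exists a, u *m A g = a *: u.
  exact/eigX/codom_f.
have scale_inj x y : x *: u = y *: u -> x = y.
  move=> /eqP; rewrite -subr_eq0 -scalerBl scaler_eq0 (negPf vX) orbF subr_eq0.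
  by move/eqP.
have chi1 : chi 1%g = 1 by apply: scale_inj; rewrite -uchi A1 mulmx1 scale1r.
have chiM g h : chi (g * h)%g = chi g * chi h.
  by apply: scale_inj; rewrite -uchi AM mulmxA uchi -scalemxAl uchi scalerA.
have [|k chik] := orb chi chi1 chiM; first by exists u.
set w := u *m S ^+ k.
have w_neq0 : w != 0 by apply: contra_neq vX => /mx_similitudeX_inj.
have wchi : is_weight (fun g => (chi g)^-1) w.
  move=> g; rewrite /w chik -[in LHS](permKV (sigma ^+ k)%g g) -mulmxA.
  by rewrite -mx_semilinearX mulmxA uchi scalemxAl.
have wSa : w *m S ^+ a = lam ^+ a *: w.
  rewrite /w -mulmxA -[S ^+ k *m _]exprD addnC exprD.
  by rewrite [S ^+ a * _]/(S ^+ a *m S ^+ k) mulmxA uSa scalemxAl.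
have pair_neq0 := dual_weights_pair chiM chi1 vX w_neq0 uchi wchi.
apply/eqP; rewrite -subr_eq0; move: pair_neq0; apply: contraNT => neq.
apply/eqP/(scalerI neq); rewrite scaler0 scalerBl; apply/eqP.
(* Evaluate the pairing of [u *m S ^+ a] and [w *m S ^+ a] in two ways. *)
rewrite subr_eq0; have <- : u *m (S ^+ a *m B *m (S ^+ a)^T) *m w^T =
    c ^+ a *: (u *m B *m w^T) by rewrite mx_similitudeX -scalemxAr -scalemxAl.
rewrite !mulmxA uSa -[X in _ == X]mulmxA -trmx_mul wSa linearZ /=.
by rewrite -!scalemxAl -scalemxAr !scalerA expr2.
Qed.

End MatrixForm.

(** * Endomorphisms and pairings in coordinates *)

Section Transfer.
Variables (R Rbar : fieldType) (iota : {rmorphism R -> Rbar}) (M : vectType R).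
Local Notation e := (vbasis {:M}).
Local Notation V := (ext_scalars Rbar M).

Let e_basis : basis_of {:M} e := vbasisP _.

Definition ext_mx (f : 'End(M)) : 'M[Rbar]_(\dim {:M}) :=
  map_mx iota (mxof e e f).

Lemma ext_endM (f : 'End(M)) (v : V) : ext_end iota f v = v *m ext_mx f.
Proof. by rewrite /ext_end lfunE. Qed.

Lemma ext_mx1 : ext_mx \1%VF = 1%:M.
Proof. by rewrite /ext_mx mxof1 ?map_mx1 // (basis_free e_basis). Qed.

Lemma ext_mx_comp (f g : 'End(M)) : ext_mx (f \o g)%VF = ext_mx g *m ext_mx f.
Proof. by rewrite /ext_mx (mxof_comp _ _ e_basis) map_mxM. Qed.

Lemma leigenvalue_ext (f : 'End(M)) lam : leigenvalue (ext_end iota f) lam ->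
  exists2 v : V, v != 0 & v *m ext_mx f = lam *: v.
Proof.
rewrite /leigenvalue -vpick0; set v := vpick _ => v_neq0; exists v => //.
have : v \in leigenspace (ext_end iota f) lam by exact: memv_pick.
rewrite memv_ker add_lfunE opp_lfunE scale_lfunE id_lfunE subr_eq0.
by move/eqP; rewrite ext_endM.
Qed.

Definition form_mx (B : {bilinear M -> M -> R^o}) : 'M[R]_(\dim {:M}) :=
  \matrix_(i, j) B e`_i e`_j.

Lemma form_mxE (B : {bilinear M -> M -> R^o}) x y :
  B x y = (rVof e x *m form_mx B *m (rVof e y)^T) 0 0.
Proof.
rewrite {1}(coord_basis e_basis (memvf x)) {1}(coord_basis e_basis (memvf y)).
rewrite linear_sumlz mxE.
under eq_bigr => i _ do rewrite linear_sumr.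
rewrite exchange_big; apply: eq_bigr => j _ /=.
rewrite !mxE mulr_suml; apply: eq_bigr => i _.
by rewrite linearZl_LR linearZr_LR !mxE /= -mulrA [RHS]mulrCA mulrC -mulrA.
Qed.

Lemma form_mx_ext (B : {bilinear M -> M -> R^o}) (f : 'End(M)) (c : R) :
    (forall x y, B (f x) (f y) = c * B x y) ->
  mxof e e f *m form_mx B *m (mxof e e f)^T = c *: form_mx B.
Proof.
move=> fB; apply/matrixP => i j; have fBij := fB e`_i e`_j.
pose row_e k : 'rV[R]_(\dim {:M}) := delta_mx 0 k.
have row_delta (N : 'M[R]_(\dim {:M})) :
    N i j = (row_e i *m N *m (row_e j)^T) 0 0.
  by rewrite trmx_delta -colE -rowE !mxE.
rewrite !form_mxE !(rVof_app _ e_basis) !(rVofE e_basis) in fBij.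
rewrite [RHS]mxE [form_mx B i j]row_delta -fBij.
by rewrite [LHS]row_delta trmx_mul !mulmxA.
Qed.

(** A row vector in the left kernel of the Gram matrix gives an [x] with [B x = 0], and [x |-> B x]
    is injective. *)
Lemma form_mx_free (B : {bilinear M -> M -> R^o}) :
  perfect_pairing B -> row_free (form_mx B).
Proof.
case=> /bij_inj B_inj _; rewrite -kermx_eq0.
apply/eqP/row_matrixP => i; rewrite row0.
set x := row i _; have xB : x *m form_mx B = 0.
  by rewrite /x -row_mul mulmx_ker row0.
apply/eqP; rewrite -(vecof_eq0 e_basis); apply/eqP/B_inj/lfunP => y.
rewrite !lfunE /= form_mxE vecofK // xB mul0mx mxE.
by rewrite linear0l.
Qed.

End Transfer.

(** * Reading the group-ring hypotheses on group elements *)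

Lemma gr_scale_delta (R : fieldType) (G : finGroupType) (M : vectType R)
    (rho : G -> 'End(M)) (g : G) (x : M) :
  gr_scale rho [ffun h => (h == g)%:R : R^o] x = rho g x.
Proof.
rewrite /gr_scale (bigD1 g) //= ffunE eqxx scale1r big1 ?addr0 // => h hg.
by rewrite ffunE (negPf hg) scale0r.
Qed.

Lemma semilinear_op_rep (R : fieldType) (G : finGroupType) (M : vectType R)
    (sigma : {perm G}) (rho : G -> 'End(M)) (Sq : 'End(M)) (g : G) :
  semilinear_op sigma rho Sq -> (Sq \o rho g = rho (sigma g) \o Sq)%VF.
Proof.
move=> Sq_semi; apply/lfunP => x; rewrite !comp_lfunE -gr_scale_delta Sq_semi.
rewrite -[RHS]gr_scale_delta; congr (gr_scale rho _ _); apply/ffunP => h.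
by rewrite !ffunE (canF_eq (permKV sigma)).
Qed.

(** The generator is the image of [[1]]; equivariance sends [[g]] to its translate by [g]. *)
Lemma equivariant_surjection_cyclic (R : fieldType) (G : finGroupType)
    (M : vectType R) (rho : G -> 'End(M)) : equivariant_surjection rho ->
  exists m : M, forall x, exists r : G -> R, x = \sum_g r g *: rho g m.
Proof.
case=> pi [piG pi_surj].
pose delta h : group_ring R G := [ffun k => (k == h)%:R : R^o].
exists (pi (delta 1%g)) => x; have [r <-] := pi_surj x; exists r.
have rE : r = \sum_g r g *: delta g.
  apply/ffunP => h; rewrite sum_ffunE (bigD1 h) //= big1 ?addr0.
    by rewrite !ffunE eqxx [RHS]mulr1.
  by move=> g gh; rewrite !ffunE eq_sym (negPf gh) scaler0.
rewrite [in LHS]rE linear_sum; apply: eq_bigr => g _; rewrite linearZ -piG /=.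
congr (_ *: pi _); by apply/ffunP => h; rewrite !ffunE -eq_mulVg1 eq_sym.
Qed.

(** As [g^#|G| = 1], the value [chi g] is itself a [#|G|]-th root of unity. *)
Lemma in_cyclo_ext_char (R Rbar : fieldType) (iota : {rmorphism R -> Rbar})
    (G : finGroupType) (chi : G -> Rbar) (g : G) :
    chi 1%g = 1 -> (forall g h, chi (g * h)%g = chi g * chi h) ->
  in_cyclo_ext iota #|G| (chi g).
Proof.
move=> chi1 chiM K _ _; apply.
have chiX k : chi (g ^+ k)%g = chi g ^+ k.
  by elim: k => [//|k IHk]; rewrite expgS chiM IHk exprS.
by rewrite -chiX -cardsT expg_cardG ?inE.
Qed.

(** * Supersingularity *)

Theorem theorem2 (p l q f d : nat) (p_prime : prime p) (l_prime : prime l)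
    (p_neq_l : p != l) (f_gt0 : (0 < f)%N) (q_def : q = (p ^ f)%N)
    (G : finGroupType) (G_abelian : abelian [set: G])
    (sigma : {perm G}) (sigma_aut : sigma \in Aut [set: G])
    (R : fieldType) (padic_to_R : {rmorphism padic l_prime -> R})
    (Rbar : closedFieldType) (iota : {rmorphism R -> Rbar})
    (Rbar_closure : is_algebraic_closure iota)
    (M : vectType R) (rho : G -> 'End(M)) (rho_rep : is_lin_rep rho)
    (Sq : 'End(M)) (Sq_semilinear : semilinear_op sigma rho Sq)
    (M_cyclic : equivariant_surjection rho)
    (M_dual : exists2 B : {bilinear M -> M -> R^o},
        perfect_pairing B & equivariant_pairing q d rho Sq B)
    (M_orbits : forall chi : G -> Rbar, is_char iota chi ->
        char_occurs iota rho chi -> in_char_orbit sigma chi (char_inv chi)) :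
  supersingular iota q Sq.
Proof.
have natr_neq0 k : (0 < k)%N -> k%:R != 0 :> Rbar.
  move=> k_gt0; rewrite -(rmorph_nat iota) -(rmorph_nat padic_to_R).
  by rewrite !fmorph_eq0 padic_natr_neq0.
have q_neq0 : q%:R != 0 :> Rbar.
  by rewrite natr_neq0 // q_def expn_gt0 prime_gt0.
have [rho1 rhoM] := rho_rep.
have [m m_gen] := equivariant_surjection_cyclic M_cyclic.
have [B /form_mx_free B_free [BG BS]] := M_dual.
have mulGC (g h : G) : (g * h = h * g)%g.
  exact: (centsP G_abelian _ (in_setT g) _ (in_setT h)).
have e_basis := vbasisP {:M}.
pose A g := ext_mx iota (rho g).
have AM g h : A (g * h)%g = A g *m A h.
  by rewrite mulGC /A rhoM ext_mx_comp.
move=> lam /leigenvalue_ext[v v_neq0 vS].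
have lamE : (lam ^+ #[sigma]%g) ^+ 2 = (q%:R ^+ d) ^+ #[sigma]%g.
  apply: (@eigenvalue_pow _ _ _ sigma A (ext_mx iota Sq)
    (map_mx iota (form_mx B)) _ (ext_vec iota m)) v_neq0 vS => //.
  - by rewrite natr_neq0 // -cardsT cardG_gt0.
  - by rewrite /A rho1 ext_mx1.
  - by move=> g h; rewrite /comm_mx -!AM mulGC.
  - by move=> g; rewrite /A -!ext_mx_comp (semilinear_op_rep _ Sq_semilinear).
  - move=> w.
    (* Basis vectors come from [M], so they expand with coefficients in [R]; [Rbar]-combinations
       then give every [w]. *)
    have /fin_all_exists[r rP] i : exists r : G -> Rbar,
        delta_mx 0 i = \sum_g r g *: (ext_vec iota m *m A g).
      have [r xr] := m_gen (vbasis {:M})`_i; exists (iota \o r).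
      rewrite -[LHS](map_delta_mx iota) -(rVofE e_basis) xr linear_sum.
      rewrite map_mx_sum; apply: eq_bigr => g _.
      by rewrite linearZ map_mxZ /= (rVof_app _ e_basis) map_mxM.
    exists (fun g => \sum_i w 0 i * r i g).
    rewrite [LHS]row_sum_delta.
    under eq_bigr => i _ do rewrite rP scaler_sumr.
    rewrite exchange_big; apply: eq_bigr => g _ /=.
    by rewrite scaler_suml; apply: eq_bigr => i _; rewrite scalerA.
  - by rewrite row_free_map.
  - move=> g; rewrite /A /ext_mx map_trmx -!map_mxM (@form_mx_ext _ _ _ _ 1).
      by rewrite scale1r.
    by move=> x y; rewrite BG mul1r.
  - rewrite /ext_mx map_trmx -!map_mxM (@form_mx_ext _ _ _ _ (q%:R ^+ d)).
      by rewrite map_mxZ rmorphXn /= rmorph_nat.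
    by move=> x y; rewrite BS /tate_frob scale_lfunE id_lfunE.
  - by rewrite expf_neq0.
  - move=> chi chi1 chiM [u u_neq0 uchi].
    have chi_char : is_char iota chi.
      by split=> // g; exact: in_cyclo_ext_char.
    have [|t /cycleP[k ->] chit] := M_orbits chi chi_char.
      by exists u => // g; rewrite ext_endM uchi.
    by exists k.
have /closed_rootP[s] : size ('X^2 - q%:R%:P : {poly Rbar}) != 1%N.
  by rewrite size_XnsubC.
rewrite /root !hornerE subr_eq0 => /eqP s2.
have s_neq0 : s != 0.
  by apply: contra_neq q_neq0 => s0; rewrite -s2 s0 expr0n.
(* With [a] the order of [sigma], [lam^(2 a) = q^(d a) = s^(2 d a)]. *)
exists s, (lam / s ^+ d), d, (#[sigma]%g * 2)%N; split=> //.
- by rewrite muln_gt0 order_gt0.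
- apply/unity_rootP; rewrite expr_div_n exprM lamE -s2 -!exprM.
  by rewrite [(2 * _)%N]mulnC -mulnA divff ?expf_neq0.
- by rewrite mulrC divfK ?expf_neq0.
Qed.
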